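(* Let $(G_i): 0\to N_i\xrightarrow{\chi_i} G_i\xrightarrow{\pi_i} Q_i\to 0$, $i=1,2$, be finite-dimensional central extensions of algebras with bracket with $\dim G_1=\dim G_2$. Then $(G_1)$ and $(G_2)$ are isoclinic if and only if they are isomorphic (as extensions).
   Context: Fix a ground field $\mathbb{K}$. An algebra with bracket (AWB) is an associative (not necessarily commutative, not necessarily unital) $\mathbb{K}$-algebra $A$ with a bilinear map $[-,-]:A\times A\to A$ satisfying $[ab,c]=[a,c]b+a[b,c]$ for all $a,b,c\in A$. Homomorphisms of AWB's are $\mathbb{K}$-linear maps preserving product and bracket; isomorphisms are bijective homomorphisms. $[[A,A]]$ denotes the two-sided ideal of $A$ spanned by all $ab$ and $[a,b]$, $a,b\in A$. The center is $Z(A)=\{a\in A: ab=ba=0,\ [a,b]=[b,a]=0\ \forall b\in A\}$. A central extension $(G): 0\to N\xrightarrow{\chi}G\xrightarrow{\pi}Q\to 0$ is a short exact sequence of AWB's with $\chi(N)\subseteq Z(G)$; it is finite-dimensional if $G$ (hence $N$ and $Q$) is finite-dimensional over $\mathbb{K}$. Its commutator maps $C,P:Q\times Q\to[[G,G]]$ are $C(q_1,q_2)=[g_1,g_2]$ and $P(q_1,q_2)=g_1g_2$, where $\pi(g_j)=q_j$. Central extensions $(G_1),(G_2)$ with commutator maps $C_i,P_i$ are isoclinic if there are AWB isomorphisms $\eta:Q_1\to Q_2$, $\xi:[[G_1,G_1]]\to[[G_2,G_2]]$ with $\xi(C_1(q,q'))=C_2(\eta(q),\eta(q'))$ and $\xi(P_1(q,q'))=P_2(\eta(q),\eta(q'))$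 for all $q,q'\in Q_1$. An isomorphism of extensions $(G_1)\to(G_2)$ is a triple $(\alpha,\beta,\gamma)$ of AWB isomorphisms $\alpha:N_1\to N_2$, $\beta:G_1\to G_2$, $\gamma:Q_1\to Q_2$ with $\beta\chi_1=\chi_2\alpha$ and $\gamma\pi_1=\pi_2\beta$. *)

(* Defs.v *)
From HB Require Import structures.
From mathcomp Require Import all_boot all_order all_algebra.
From mathcomp Require Import boolp.

Set Implicit Arguments.
Unset Strict Implicit.
Unset Printing Implicit Defensive.

Import GRing.Theory.
Local Open Scope ring_scope.

(* The product is neither commutative nor unital, so MathComp's ring structures
   do not apply and it is part of the mixin. *)
HB.mixin Record Lmodule_isAWB (K : fieldType) A & GRing.Lmodule K A := {
  awb_mul : A -> A -> A;
  awb_br : A -> A -> A;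
  awb_mul_linear_l : forall b, linear (awb_mul^~ b);
  awb_mul_linear_r : forall a, linear (awb_mul a);
  awb_br_linear_l : forall b, linear (awb_br^~ b);
  awb_br_linear_r : forall a, linear (awb_br a);
  awb_mulA : associative awb_mul;
  awb_br_mul : forall a b c,
    awb_br (awb_mul a b) c = awb_mul (awb_br a c) b + awb_mul a (awb_br b c)
}.

#[short(type="awbType")]
HB.structure Definition AWB (K : fieldType) :=
  { A of GRing.Lmodule K A & Lmodule_isAWB K A }.

#[short(type="fdAwbType")]
HB.structure Definition FinDimAWB (K : fieldType) :=
  { A of Vector K A & Lmodule_isAWB K A }.

HB.mixin Record isAWBMorphism (K : fieldType) (A B : awbType K)
    (f : A -> B) := {
  awb_morphM : {morph f : a b / awb_mul a b};
  awb_morphB : {morph f : a b / awb_br a b}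
}.

#[short(type="awbHom")]
HB.structure Definition AWBMorphism (K : fieldType) (A B : awbType K) :=
  { f of @GRing.Linear K A B *:%R f & isAWBMorphism K A B f }.

Definition awb_center (K : fieldType) (A : awbType K) (a : A) : Prop :=
  forall b : A, [/\ awb_mul a b = 0, awb_mul b a = 0,
                    awb_br a b = 0 & awb_br b a = 0].

(* The K-linear span of all products and brackets; it is already a two-sided
   ideal, see in_derived_ideal. *)
Inductive in_derived (K : fieldType) (A : awbType K) : A -> Prop :=
| in_derived_mul a b : in_derived (awb_mul a b)
| in_derived_br a b : in_derived (awb_br a b)
| in_derived0 : in_derived 0
| in_derivedP (k : K) x y :
    in_derived x -> in_derived y -> in_derived (k *: x + y).

Lemma in_derived_ideal (K : fieldType) (A : awbType K) (x b : A) :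
  in_derived x ->
  [/\ in_derived (awb_mul x b), in_derived (awb_mul b x),
      in_derived (awb_br x b) & in_derived (awb_br b x)].
Proof. by move=> _; split; constructor. Qed.

Definition derived_pred (K : fieldType) (A : awbType K) : {pred A} :=
  fun x => `[< in_derived x >].

Lemma derived_pred_submod (K : fieldType) (A : awbType K) :
  submod_closed (@derived_pred K A).
Proof.
split; first by apply/asboolP; exact: in_derived0.
by move=> k x y /asboolP hx /asboolP hy; apply/asboolP; exact: in_derivedP.
Qed.

HB.instance Definition _ (K : fieldType) (A : awbType K) :=
  GRing.isSubmodClosed.Build K A (@derived_pred K A) (@derived_pred_submod K A).

(* derived A is the algebra [[A,A]], with the operations of A. *)
Record derived (K : fieldType) (A : awbType K) := Derived {
  derived_val :> A;
  _ : derived_val \in @derived_pred K A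
}.

HB.instance Definition _ (K : fieldType) (A : awbType K) :=
  [isSub for @derived_val K A].
HB.instance Definition _ (K : fieldType) (A : awbType K) :=
  [Choice of derived A by <:].
HB.instance Definition _ (K : fieldType) (A : awbType K) :=
  [SubChoice_isSubLmodule of derived A by <:].

Lemma mul_in_derived (K : fieldType) (A : awbType K) (a b : A) :
  awb_mul a b \in @derived_pred K A.
Proof. by apply/asboolP; exact: in_derived_mul. Qed.

Lemma br_in_derived (K : fieldType) (A : awbType K) (a b : A) :
  awb_br a b \in @derived_pred K A.
Proof. by apply/asboolP; exact: in_derived_br. Qed.

Definition to_derived_mul (K : fieldType) (A : awbType K) (a b : A) :
  derived A := Derived (mul_in_derived a b).

Definition to_derived_br (K : fieldType) (A : awbType K) (a b : A) :
  derived A := Derived (br_in_derived a b).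

Section DerivedAWB.
Variables (K : fieldType) (A : awbType K).

Let dmul (x y : derived A) : derived A := to_derived_mul (x : A) (y : A).
Let dbr (x y : derived A) : derived A := to_derived_br (x : A) (y : A).

Let dmul_linear_l b : linear (dmul^~ b).
Proof. by move=> k x y; apply: val_inj; exact: awb_mul_linear_l. Qed.

Let dmul_linear_r a : linear (dmul a).
Proof. by move=> k x y; apply: val_inj; exact: awb_mul_linear_r. Qed.

Let dbr_linear_l b : linear (dbr^~ b).
Proof. by move=> k x y; apply: val_inj; exact: awb_br_linear_l. Qed.

Let dbr_linear_r a : linear (dbr a).
Proof. by move=> k x y; apply: val_inj; exact: awb_br_linear_r. Qed.

Let dmulA : associative dmul.
Proof. by move=> x y z; apply: val_inj; exact: awb_mulA. Qed.

Let dbr_mul x y z : dbr (dmul x y) z = dmul (dbr x z) y + dmul x (dbr y z).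
Proof. by apply: val_inj; exact: awb_br_mul. Qed.

HB.instance Definition _ := Lmodule_isAWB.Build K (derived A)
  dmul_linear_l dmul_linear_r dbr_linear_l dbr_linear_r dmulA dbr_mul.

End DerivedAWB.

Record central_extension (K : fieldType) (N G Q : awbType K) :=
    CentralExtension {
  ext_chi : awbHom N G;
  ext_pi : awbHom G Q;
  ext_chi_inj : injective ext_chi;
  ext_pi_surj : forall q, exists g, ext_pi g = q;
  ext_exact : forall g, ext_pi g = 0 <-> exists n, ext_chi n = g;
  ext_central : forall n, awb_center (ext_chi n)
}.

Section CommutatorMaps.
Variables (K : fieldType) (N G Q : awbType K) (E : central_extension N G Q).

Definition ext_lift (q : Q) : G := sval (cid (ext_pi_surj E q)).

Lemma ext_liftK q : ext_pi E (ext_lift q) = q.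
Proof. exact: svalP (cid (ext_pi_surj E q)). Qed.

Definition commC (q1 q2 : Q) : derived G :=
  to_derived_br (ext_lift q1) (ext_lift q2).

Definition commP (q1 q2 : Q) : derived G :=
  to_derived_mul (ext_lift q1) (ext_lift q2).

(* commC and commP do not depend on the chosen preimages. *)
Lemma ext_lift_central g : exists2 z, awb_center z & ext_lift (ext_pi E g) = g + z.
Proof.
have /ext_exact [n hn] : ext_pi E (ext_lift (ext_pi E g) - g) = 0.
  by rewrite linearB /= ext_liftK subrr.
by exists (ext_chi E n); [exact: ext_central | rewrite hn addrC subrK].
Qed.

Lemma commCE g1 g2 : commC (ext_pi E g1) (ext_pi E g2) = to_derived_br g1 g2.
Proof.
apply: val_inj => /=.
have [z1 c1 ->] := ext_lift_central g1; have [z2 c2 ->] := ext_lift_central g2.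
have := awb_br_linear_l (g2 + z2) 1 g1 z1; rewrite /= !scale1r => ->.
have := awb_br_linear_r g1 1 g2 z2; rewrite !scale1r => ->.
by have [_ _ -> _] := c1 (g2 + z2); have [_ _ _ ->] := c2 g1; rewrite !addr0.
Qed.

Lemma commPE g1 g2 : commP (ext_pi E g1) (ext_pi E g2) = to_derived_mul g1 g2.
Proof.
apply: val_inj => /=.
have [z1 c1 ->] := ext_lift_central g1; have [z2 c2 ->] := ext_lift_central g2.
have := awb_mul_linear_l (g2 + z2) 1 g1 z1; rewrite /= !scale1r => ->.
have := awb_mul_linear_r g1 1 g2 z2; rewrite !scale1r => ->.
by have [-> _ _ _] := c1 (g2 + z2); have [_ -> _ _] := c2 g1; rewrite !addr0.
Qed.

End CommutatorMaps.

Definition isoclinic (K : fieldType) (N1 G1 Q1 N2 G2 Q2 : awbType K)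
    (E1 : central_extension N1 G1 Q1) (E2 : central_extension N2 G2 Q2) : Prop :=
  exists (eta : awbHom Q1 Q2) (xi : awbHom (derived G1) (derived G2)),
    [/\ bijective eta, bijective xi,
        forall q q', xi (commC E1 q q') = commC E2 (eta q) (eta q') &
        forall q q', xi (commP E1 q q') = commP E2 (eta q) (eta q')].

Definition ext_isomorphic (K : fieldType) (N1 G1 Q1 N2 G2 Q2 : awbType K)
    (E1 : central_extension N1 G1 Q1) (E2 : central_extension N2 G2 Q2) : Prop :=
  exists (alpha : awbHom N1 N2) (beta : awbHom G1 G2) (gamma : awbHom Q1 Q2),
    [/\ bijective alpha, bijective beta, bijective gamma,
        forall n, beta (ext_chi E1 n) = ext_chi E2 (alpha n) &
        forall g, gamma (ext_pi E1 g) = ext_pi E2 (beta g)].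

(* Main.v *)
Require Import Defs.
From HB Require Import structures.
From mathcomp Require Import all_boot all_algebra.
From mathcomp Require Import boolp.

(** The content is linear algebra. Let (eta, xi) be an isoclinism. A linear map
    b : G1 -> G2 that lifts eta and restricts to xi on [[G1, G1]] is
    automatically multiplicative: a product ab lies in [[G1, G1]], so b sends it
    to xi(ab) = xi(P1(pi a, pi b)) = P2(eta(pi a), eta(pi b)) = b(a)b(b), the
    last step because b(a) and b(b) are preimages of eta(pi a) and eta(pi b).
    The same holds for brackets. A bijective b of this kind is therefore the
    middle component of an isomorphism of extensions, whose left component is
    then forced ([ext_isomorphic_of_middle]).

    It remains to find an injective b; equality of dimensions makes it
    bijective. The map xi is an injective lift of eta on the subspace [[G1, G1]]
    ([isoclinism_pi]), and [extend_injective_lift] extends any injective partial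
    lift to the whole space, one vector at a time. If the partial lift f on a
    proper subspace S could not be extended injectively, every lift of every
    vector outside S would lie in f(S). Since two lifts of the same vector
    differ by an arbitrary element of the kernel N2, this would put N2 inside
    f(S). Every w in G2 is a lift of some v in G1, so it would lie in f(S) too:
    directly if v is outside S, and because w - f(v) is in N2 if v is in S. This
    contradicts dim f(S) < dim G1 = dim G2.

    Conversely, the middle component of an isomorphism of extensions maps
    products to products and brackets to brackets, hence restricts to an
    isomorphism of the derived ideals, which is compatible with the commutator
    maps. *)

Set Implicit Arguments.
Unset Strict Implicit.
Unset Printing Implicit Defensive.

Import GRing.Theory.
Local Open Scope ring_scope.

(** * Linear algebra *)

Lemma inj_surj_bij (A B : Type) (f : A -> B) :
  injective f -> (forall b, exists a, f a = b) -> bijective f.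
Proof.
move=> finj fsurj; have [g fg] := choice fsurj.
by exists g => // a; apply: finj; rewrite fg.
Qed.

Lemma inj_dim_bij (K : fieldType) (V W : vectType K) (g : {linear V -> W}) :
  \dim {:V} = \dim {:W} -> injective g -> bijective g.
Proof.
move=> dimVW ginj; apply: inj_surj_bij => // w.
have ker0 : lker (linfun g) == 0%VS.
  by apply/lker0P => x y; rewrite !lfunE => /ginj.
have img : limg (linfun g) = {:W}%VS.
  apply/eqP; rewrite eqEdim subvf -dimVW.
  by rewrite -(limg_ker_dim (linfun g) {:V}) (eqP ker0) capv0 dimv0 add0n leqnn.
have /memv_imgP [v _ ->] : w \in limg (linfun g) by rewrite img memvf.
by exists v; rewrite lfunE.
Qed.

Lemma codim_adjoin (K : fieldType) (V : vectType K) (S : {vspace V}) v n :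
  v \notin S -> (\dim {:V} - \dim S <= n.+1)%N ->
  (\dim {:V} - \dim (<[v]> + S) <= n)%N.
Proof.
move=> vS dimS; have dimlt : (\dim S < \dim (<[v]> + S))%N.
  rewrite ltnNge; apply: contraNN vS => dS.
  have /eqP -> : S == (<[v]> + S)%VS by rewrite eqEdim addvSr.
  exact: subvP (addvSl _ _) _ (memv_line v).
rewrite -ltnS (leq_trans _ dimS) // ltn_sub2l //.
exact: leq_trans dimlt (dimvS (subvf _)).
Qed.

Lemma codim0_full (K : fieldType) (V : vectType K) (S : {vspace V}) :
  (\dim {:V} - \dim S <= 0)%N -> S = {:V}%VS.
Proof. by rewrite leqn0 subn_eq0 => dS; apply/eqP; rewrite eqEdim subvf. Qed.

(** Subspaces of a finite-dimensional space given by arbitrary, possibly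
    undecidable, predicates are honest subspaces: adjoining vectors of [P] one
    at a time stops by the bound on the dimension. It makes the derived ideal,
    an inductively generated span, available as a [{vspace G}]. *)
Lemma vspace_of_submod (K : fieldType) (V : vectType K) (P : {pred V}) :
  submod_closed P -> exists U : {vspace V}, U =i P.
Proof.
move=> [P0 PS].
suff ext n (U : {vspace V}) :
    (\dim {:V} - \dim U <= n)%N -> {subset U <= P} ->
    exists U' : {vspace V}, U' =i P.
  by apply: (ext _ 0%VS (leqnn _)) => x; rewrite memv0 => /eqP ->.
elim: n U => [|n IHn] U dimU UP.
  by exists U => x; rewrite UP (codim0_full dimU) memvf.
have [[x Px xU]|PU] := pselect (exists2 x, x \in P & x \notin U); last first.
  exists U => x; apply/idP/idP => [/UP //|Px].
  by apply/negPn/negP => xU; apply: PU; exists x.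
apply: (IHn (<[x]> + U)%VS); first exact: codim_adjoin.
by move=> y /memv_addP[_ /vlineP[k ->] [u uU ->]]; apply: PS => //; exact: UP.
Qed.

Lemma eq_on_span (K : fieldType) (V : vectType K) (W : lmodType K)
    (X : seq V) (f g : {linear V -> W}) :
  {in X, f =1 g} -> {in <<X>>%VS, f =1 g}.
Proof.
move=> fgX x xX; rewrite (coord_span (X := in_tuple X) xX) !linear_sum.
by apply: eq_bigr => i _; rewrite !linearZ /= fgX // mem_nth.
Qed.

Lemma extend_by_vector (K : fieldType) (V W : vectType K) (S : {vspace V})
    (f : {linear V -> W}) v w :
  v \notin S ->
  exists g : {linear V -> W}, {in S, g =1 f} /\ g v = w.
Proof.
move=> vS.
have [g gE] := linear_of_free (v :: vbasis S) (w :: map f (vbasis S)).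
have spanS : <<vbasis S>>%VS = S by apply: span_basis; exact: vbasisP.
have /gE : free (v :: vbasis S).
  by rewrite free_cons spanS vS; apply: basis_free (vbasisP S).
rewrite /= size_map => /(_ erefl) [gv gS]; exists g; split=> //.
have := @eq_on_span _ _ _ (vbasis S) g f; rewrite spanS; apply.
by apply/eq_in_map.
Qed.

(** Induction on the codimension of [S]. A vector [v] outside [S] can be sent
    to any lift [u] of [p v] outside [f @: S] without losing injectivity. To
    find such a pair, start from any [w] outside [f @: S]: either it lifts the
    image of a vector outside [S], or it differs from a value of [f] by a kernel
    vector that can be used to correct a badly placed lift. *)
Lemma extend_injective_lift (K : fieldType) (V W : vectType K) (Q : lmodType K)
    (p : {linear V -> Q}) (r : {linear W -> Q}) :
  (forall q, exists v, p v = q) -> (forall q, exists w, r w = q) ->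
  \dim {:V} = \dim {:W} ->
  forall (S : {vspace V}) (f : {linear V -> W}),
  {in S, forall x, f x = 0 -> x = 0} -> {in S, forall x, r (f x) = p x} ->
  exists g : {linear V -> W},
    [/\ injective g, forall x, r (g x) = p x & {in S, g =1 f}].
Proof.
move=> psurj rsurj dimVW S.
move: {2}(\dim {:V} - \dim S)%N (leqnn (\dim {:V} - \dim S)) => n.
elim: n S => [|n IHn] S dimS f finj frp.
  have SV := codim0_full dimS.
  exists f; split=> // [x y fxy|x]; last by rewrite frp // SV memvf.
  apply/eqP; rewrite -subr_eq0; apply/eqP/finj; first by rewrite SV memvf.
  by rewrite linearB fxy subrr.
have [SV|SneV] := eqVneq S {:V}%VS.
  by apply: IHn; rewrite // SV subnn.
have dimSV : (\dim S < \dim {:V})%N.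
  rewrite ltnNge; apply: contraNN SneV => dS.
  by rewrite eqEdim subvf dS.
have memfS x : x \in S -> f x \in (linfun f @: S)%VS.
  by move=> xS; apply/memv_imgP; exists x; rewrite ?lfunE.
have [w wS] : exists w, w \notin (linfun f @: S)%VS.
  have [//|nex] := pselect (exists w, w \notin (linfun f @: S)%VS).
  suff : (\dim {:W} <= \dim S)%N by rewrite -dimVW leqNgt dimSV.
  apply: (@leq_trans (\dim (linfun f @: S))); last first.
    by rewrite -(limg_ker_dim (linfun f) S) leq_addl.
  apply: dimvS; apply/subvP => w _; apply/negPn/negP => wS; apply: nex.
  by exists w.
have [v [u [vS uS ruv]]] :
    exists v u, [/\ v \notin S, u \notin (linfun f @: S)%VS & r u = p v].
  have [v pv] := psurj (r w).
  have [vS|vS] := boolP (v \in S); last by exists v, w.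
  (* Here w - f v is a kernel vector of r outside f @: S: adding it to a lift
     lying in f @: S moves that lift out of f @: S. *)
  have [v' v'S] : exists v', v' \notin S.
    have [//|nex] := pselect (exists v', v' \notin S).
    case/negP: SneV; rewrite eqEsubv subvf; apply/subvP => x _.
    by apply/negPn/negP => xS; apply: nex; exists x.
  have [u ru] := rsurj (p v').
  have [uS|uS] := boolP (u \in (linfun f @: S)%VS); last by exists v', u.
  exists v', (u + (w - f v)); split=> //.
    by rewrite rpredDl // rpredBr // memfS.
  by rewrite linearD linearB /= frp // pv subrr addr0.
have [g [gf gv]] := extend_by_vector f u vS.
have [||h [hinj hrp hg]] := IHn _ (codim_adjoin vS dimS) g.
- move=> _ /memv_addP[_ /vlineP[k ->] [s sS ->]].
  rewrite linearP gv gf //; have [->|k0] := eqVneq k 0.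
    by rewrite !scale0r !add0r; exact: finj.
  move=> /eqP; rewrite addr_eq0 => /eqP kue; case/negP: uS.
  (* A relation k u + f s = 0 with k <> 0 would put u in f @: S. *)
  have -> : u = f (- k^-1 *: s).
    by rewrite linearZ /= scaleNr -scalerN -kue scalerA mulVf // scale1r.
  by rewrite memfS // rpredZ.
- move=> _ /memv_addP[_ /vlineP[k ->] [s sS ->]].
  by rewrite !linearP /= gv gf // ruv frp.
exists h; split=> // x xS; rewrite hg ?gf //.
exact: subvP (addvSr _ _) _ xS.
Qed.

(** * Morphisms and extensions *)

Lemma awbHom_of (K : fieldType) (A B : awbType K) (f : A -> B) :
  linear f -> {morph f : a b / awb_mul a b} -> {morph f : a b / awb_br a b} ->
  exists h : awbHom A B, h =1 f.
Proof.
move=> flin fM fB.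
pose lf := GRing.isLinear.Build K A B *:%R f flin.
pose mf := isAWBMorphism.Build K A B f fM fB.
pose h : awbHom A B := HB.pack f lf mf.
by exists h.
Qed.

(** A linear retraction onto the derived ideal turns linear maps defined on
    [derived G] into linear maps defined on all of [G], to which
    [extend_injective_lift] applies. *)
Lemma derived_retract (K : fieldType) (G : fdAwbType K) :
  exists U : {vspace G}, exists p : {linear G -> derived G},
    U =i derived_pred (A := G) /\ {in U, forall x, derived_val (p x) = x}.
Proof.
have [U UE] := vspace_of_submod (@derived_pred_submod K G).
have pU x : projv U x \in @derived_pred K G by rewrite -UE memv_proj.
pose p x : derived G := Derived (pU x).
have plin : linear p by move=> k x y; apply: val_inj; rewrite /= linearP.
pose pl : {linear G -> derived G} :=
  HB.pack p (GRing.isLinear.Build K G (derived G) *:%R p plin).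
by exists U, pl; split=> // x xU /=; exact: projv_id.
Qed.

(** By exactness the kernels are the images of the maps chi, so an isomorphism
    of the middle terms lying over an isomorphism of the quotients carries one
    onto the other and so induces the isomorphism of the left terms. *)
Lemma ext_isomorphic_of_middle (K : fieldType) (N1 G1 Q1 N2 G2 Q2 : awbType K)
    (E1 : central_extension N1 G1 Q1) (E2 : central_extension N2 G2 Q2)
    (beta : awbHom G1 G2) (gamma : awbHom Q1 Q2) :
  bijective beta -> bijective gamma ->
  (forall g, gamma (ext_pi E1 g) = ext_pi E2 (beta g)) ->
  ext_isomorphic E1 E2.
Proof.
move=> betab gammab comm.
have alphaP n : exists n', ext_chi E2 n' = beta (ext_chi E1 n).
  apply/ext_exact; rewrite -comm.
  have /ext_exact -> : exists n0, ext_chi E1 n0 = ext_chi E1 n by exists n.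
  exact: linear0.
have [a aE] := choice alphaP.
have chi2I := @ext_chi_inj _ _ _ _ E2.
have [|||alpha alphaE] := @awbHom_of K N1 N2 a.
- by move=> k x y; apply: chi2I; rewrite linearP /= !aE !linearP.
- by move=> x y; apply: chi2I; rewrite awb_morphM !aE !awb_morphM.
- by move=> x y; apply: chi2I; rewrite awb_morphB !aE !awb_morphB.
have chi_alpha n : beta (ext_chi E1 n) = ext_chi E2 (alpha n).
  by rewrite alphaE aE.
exists alpha, beta, gamma; split=> //; apply: inj_surj_bij => [x y|n'].
  move=> /(congr1 (ext_chi E2)); rewrite -!chi_alpha => /(bij_inj betab).
  exact: ext_chi_inj.
have [beta' _ betaK] := betab.
have /ext_exact [n nE] : ext_pi E1 (beta' (ext_chi E2 n')) = 0.
  apply: (bij_inj gammab); rewrite comm betaK linear0.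
  by apply/ext_exact; exists n'.
by exists n; apply: chi2I; rewrite -chi_alpha nE betaK.
Qed.

(** Both sides are linear in [d], and on a generator P1(q, q') both are the
    product of eta(q) and eta(q'), because pi maps P(q, q') to qq'; likewise for
    brackets. *)
Lemma isoclinism_pi (K : fieldType) (N1 G1 Q1 N2 G2 Q2 : awbType K)
    (E1 : central_extension N1 G1 Q1) (E2 : central_extension N2 G2 Q2)
    (eta : awbHom Q1 Q2) (xi : awbHom (derived G1) (derived G2)) :
  (forall q q', xi (commC E1 q q') = commC E2 (eta q) (eta q')) ->
  (forall q q', xi (commP E1 q q') = commP E2 (eta q) (eta q')) ->
  forall d : derived G1, ext_pi E2 (derived_val (xi d)) =
    eta (ext_pi E1 (derived_val d)).
Proof.
move=> xiC xiP [x xP]; have /asboolP xD := xP.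
elim: xD xP => [a b|a b||k u v uD IHu vD IHv] xP /=.
- have -> : Derived xP = commP E1 (ext_pi E1 a) (ext_pi E1 b).
    by rewrite commPE; exact: val_inj.
  by rewrite xiP /= !awb_morphM !ext_liftK.
- have -> : Derived xP = commC E1 (ext_pi E1 a) (ext_pi E1 b).
    by rewrite commCE; exact: val_inj.
  by rewrite xiC /= !awb_morphB !ext_liftK.
- have -> : Derived xP = 0 by exact: val_inj.
  by rewrite !linear0.
- have uP : u \in @derived_pred K G1 by apply/asboolP.
  have vP : v \in @derived_pred K G1 by apply/asboolP.
  have -> : Derived xP = k *: Derived uP + Derived vP by exact: val_inj.
  by rewrite !linearP /= IHu IHv.
Qed.

(** * Isoclinism and isomorphism *)

Lemma isoclinic_of_isomorphic (K : fieldType) (N1 G1 Q1 N2 G2 Q2 : awbType K)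
    (E1 : central_extension N1 G1 Q1) (E2 : central_extension N2 G2 Q2) :
  ext_isomorphic E1 E2 -> isoclinic E1 E2.
Proof.
move=> [_ [beta [gamma [_ betab gammab _ comm]]]].
have betaD x : x \in @derived_pred K G1 -> beta x \in @derived_pred K G2.
  move=> /asboolP xD; apply/asboolP.
  elim: xD => [a b|a b||k u v _ uD _ vD].
  - by rewrite awb_morphM; constructor.
  - by rewrite awb_morphB; constructor.
  - by rewrite linear0; constructor.
  - by rewrite linearP; constructor.
pose b (d : derived G1) : derived G2 := Derived (betaD _ (valP d)).
have [|||xi xiE] := @awbHom_of K _ _ b.
- by move=> k x y; apply: val_inj; rewrite /= linearP.
- by move=> x y; apply: val_inj; rewrite /= awb_morphM.
- by move=> x y; apply: val_inj; rewrite /= awb_morphB.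
exists gamma, xi; split=> //.
- apply: inj_surj_bij => [x y|[y yP]].
    by rewrite !xiE => /(congr1 val) /(bij_inj betab) /val_inj.
  have [beta' _ betaK] := betab.
  (* beta' preserves all operations, as the inverse of beta. *)
  have xD : beta' y \in @derived_pred K G1.
    have /asboolP yD := yP; apply/asboolP.
    have betaI := bij_inj betab.
    elim: yD => [u v|u v||k u v _ uD _ vD].
    + have -> : beta' (awb_mul u v) = awb_mul (beta' u) (beta' v).
        by apply: betaI; rewrite awb_morphM !betaK.
      by constructor.
    + have -> : beta' (awb_br u v) = awb_br (beta' u) (beta' v).
        by apply: betaI; rewrite awb_morphB !betaK.
      by constructor.
    + have -> : beta' 0 = 0 by apply: betaI; rewrite betaK linear0.
      by constructor.
    + have -> : beta' (k *: u + v) = k *: beta' u + beta' v.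
        by apply: betaI; rewrite linearP /= !betaK.
      by constructor.
  by exists (Derived xD); rewrite xiE; apply: val_inj; exact: betaK.
- move=> q q'; rewrite -(ext_liftK E1 q) -(ext_liftK E1 q') !comm !commCE.
  by rewrite xiE; apply: val_inj; rewrite /= awb_morphB.
- move=> q q'; rewrite -(ext_liftK E1 q) -(ext_liftK E1 q') !comm !commPE.
  by rewrite xiE; apply: val_inj; rewrite /= awb_morphM.
Qed.

Lemma isomorphic_of_isoclinic (K : fieldType) (N1 Q1 N2 Q2 : awbType K)
    (G1 G2 : fdAwbType K)
    (E1 : central_extension N1 G1 Q1) (E2 : central_extension N2 G2 Q2) :
  \dim {:G1} = \dim {:G2} -> isoclinic E1 E2 -> ext_isomorphic E1 E2.
Proof.
move=> dimG [eta [xi [etab xib xiC xiP]]].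
have xi_pi := isoclinism_pi xiC xiP.
have [U [p [UE pE]]] := derived_retract G1.
have surj1 q : exists g, (eta \o ext_pi E1) g = q.
  have [eta' _ etaK] := etab; have [g gE] := ext_pi_surj E1 (eta' q).
  by exists g; rewrite /= gE etaK.
have [||b [binj bpi bxi]] := extend_injective_lift surj1 (ext_pi_surj E2) dimG
  (S := U) (f := \val \o (xi \o p)).
- move=> x xU /= xi0; rewrite -(pE x xU).
  suff -> : p x = 0 by [].
  by apply: (bij_inj xib); apply: val_inj; rewrite linear0.
- by move=> x xU /=; rewrite xi_pi pE.
have bQ x : eta (ext_pi E1 x) = ext_pi E2 (b x) by rewrite bpi.
have bD (d : derived G1) : b (derived_val d) = derived_val (xi d).
  have dU : derived_val d \in U by rewrite UE; exact: valP.
  by rewrite bxi //=; congr (derived_val (xi _)); apply: val_inj; exact: pE.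
have [|||beta betaE] := @awbHom_of K G1 G2 b.
- exact: linearP.
- move=> x y; rewrite (bD (to_derived_mul x y)) -(commPE E1) xiP.
  by rewrite !bQ commPE.
- move=> x y; rewrite (bD (to_derived_br x y)) -(commCE E1) xiC.
  by rewrite !bQ commCE.
apply: (@ext_isomorphic_of_middle _ _ _ _ _ _ _ E1 E2 beta eta) => // [|g].
  exact: eq_bij (inj_dim_bij dimG binj) _ (fsym betaE).
by rewrite betaE bQ.
Qed.

Theorem corollary5p9 (K : fieldType) (N1 Q1 N2 Q2 : awbType K)
    (G1 G2 : fdAwbType K)
    (E1 : central_extension N1 G1 Q1) (E2 : central_extension N2 G2 Q2) :
  \dim (fullv : {vspace G1}) = \dim (fullv : {vspace G2}) ->
  isoclinic E1 E2 <-> ext_isomorphic E1 E2.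
Proof.
move=> dimG; split; last exact: isoclinic_of_isomorphic.
exact: isomorphic_of_isoclinic.
Qed.
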